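(* Let $G$ be a bipartite graph and let $k$ be a positive integer. If the $k$-core of $G$ is empty, then the maximal typical completion rank of $G$ is less than $k$.
   Context: A bipartite graph $G=(R\cup C,E)$ is finite, with parts $R$ (of size $m$) and $C$ (of size $n$) and edge set $E\subseteq R\times C$. The $k$-core of a graph is its maximal subgraph in which all vertices have degree at least $k$; equivalently, the graph obtained by iteratively deleting vertices of degree less than $k$. A $G$-partial matrix over $\mathbb{R}$ is a vector $M=(M_{ij})_{(i,j)\in E}\in \mathbb{R}^E$. A completion of $M$ is an $m\times n$ real matrix $A$, rows indexed by $R$ and columns indexed by $C$, with $A_{ij}=M_{ij}$ for all $(i,j)\in E$. The real completion rank of $M$ is the smallest rank of a real completion of $M$. An integer $r$ is a typical completion rank of $G$ if the set of $M\in\mathbb{R}^E$ with real completion rank $r$ has nonempty interior in the Euclidean topology. *)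

(* Defs.v *)
From mathcomp Require Import all_boot all_order all_algebra.
From mathcomp Require Import all_classical all_reals all_analysis.

Set Implicit Arguments.
Unset Strict Implicit.
Unset Printing Implicit Defensive.

Import Order.TTheory GRing.Theory Num.Theory.
Import numFieldNormedType.Exports.

Local Open Scope ring_scope.

(* A bipartite graph with parts 'I_m and 'I_n is given by its edge set
   E : {set 'I_m * 'I_n}; every element of 'I_m and 'I_n is a vertex. *)

Section KCore.
Variables m n : nat.
Implicit Types (E : {set 'I_m * 'I_n}) (k : nat).

(* A subgraph candidate: (vertices in 'I_m, vertices in 'I_n, edges). *)
Definition bigraph : Type :=
  ({set 'I_m} * {set 'I_n} * {set 'I_m * 'I_n})%type.

Implicit Types H : bigraph.

Definition rows H : {set 'I_m} := H.1.1.
Definition cols H : {set 'I_n} := H.1.2.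
Definition edges H : {set 'I_m * 'I_n} := H.2.

Definition null_bigraph : bigraph := (finset.set0, finset.set0, finset.set0).

Definition is_subgraph E H : bool :=
  (edges H \subset E) && (edges H \subset finset.setX (rows H) (cols H)).

Definition row_degree H (i : 'I_m) : nat := #|[set e in edges H | e.1 == i]%SET|.
Definition col_degree H (j : 'I_n) : nat := #|[set e in edges H | e.2 == j]%SET|.

Definition min_degree_ge k H : bool :=
  [forall i in rows H, (k <= row_degree H i)%N] &&
  [forall j in cols H, (k <= col_degree H j)%N].

Definition bigraph_le H1 H2 : bool :=
  [&& rows H1 \subset rows H2, cols H1 \subset cols H2
    & edges H1 \subset edges H2].

(* The union of all subgraphs of minimum degree at least k; [k_coreP] shows
   that it is the largest such subgraph. *)
Definition k_core k E : bigraph :=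
  let P H := is_subgraph E H && min_degree_ge k H in
  ((\bigcup_(H : bigraph | P H) rows H)%SET,
   (\bigcup_(H : bigraph | P H) cols H)%SET,
   (\bigcup_(H : bigraph | P H) edges H)%SET).

Lemma k_coreP k E :
  [/\ is_subgraph E (k_core k E), min_degree_ge k (k_core k E)
    & forall H, is_subgraph E H -> min_degree_ge k H ->
        bigraph_le H (k_core k E)].
Proof.
have le_core H : is_subgraph E H -> min_degree_ge k H ->
    bigraph_le H (k_core k E).
  move=> sH dH; rewrite /bigraph_le /k_core /rows /cols /edges /=.
  by apply/and3P; split; apply: (finset.bigcup_sup H); rewrite ?sH ?dH.
split=> //.
  apply/andP; split; apply/finset.bigcupsP => H /andP[sH dH].
    by case/andP: sH.
  have /and3P[sr sc _] := le_core H sH dH.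
  by case/andP: (sH) => _ /fintype.subset_trans; apply; apply: finset.setXS.
apply/andP; split; apply/forall_inP => v /finset.bigcupP[H /andP[sH dH] vH].
  case/andP: (dH) => /forall_inP /(_ v vH) /leq_trans + _; apply.
  have /and3P[_ _ /fintype.subsetP se] := le_core H sH dH.
  apply: subset_leq_card; apply/fintype.subsetP => e.
  by rewrite !inE => /andP[/se -> ->].
case/andP: (dH) => _ /forall_inP /(_ v vH) /leq_trans; apply.
have /and3P[_ _ /fintype.subsetP se] := le_core H sH dH.
apply: subset_leq_card; apply/fintype.subsetP => e.
by rewrite !inE => /andP[/se -> ->].
Qed.

End KCore.

Section Completion.
Variables (R : realType) (m n : nat) (E : {set 'I_m * 'I_n}).

(* R^E is encoded as 'rV[R]_#|E|, the coordinate e being the entry at the edge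
   enum_val e; the topology of 'rV[R]_#|E| is the Euclidean one. *)
Definition completion (M : 'rV[R]_#|E|) (A : 'M[R]_(m, n)) : bool :=
  [forall e : 'I_#|E|, A (enum_val e).1 (enum_val e).2 == M ord0 e].

Lemma completion_rank_ex (M : 'rV[R]_#|E|) :
  exists r, `[< exists2 A : 'M[R]_(m, n), completion M A & \rank A = r >].
Proof.
pose A : 'M[R]_(m, n) := \matrix_(i, j)
  \sum_(e < #|E| | enum_val e == (i, j)) M ord0 e.
exists (\rank A); apply/asboolP; exists A => //.
apply/forallP => e; rewrite mxE (big_pred1 e) // => f /=.
by rewrite -surjective_pairing (inj_eq enum_val_inj).
Qed.

Definition completion_rank (M : 'rV[R]_#|E|) : nat :=
  ex_minn (completion_rank_ex M).

Definition typical_rank (r : nat) : Prop :=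
  (interior [set M : 'rV[R]_#|E| | completion_rank M = r] !=set0)%classic.

Lemma completion_rank_le (M : 'rV[R]_#|E|) :
  (completion_rank M <= minn m n)%N.
Proof.
rewrite /completion_rank; case: ex_minnP => r /asboolP[A _ <-] _.
by rewrite leq_min rank_leq_row rank_leq_col.
Qed.

Lemma typical_rank_le r : typical_rank r -> (r <= minn m n)%N.
Proof. by case=> M /interior_subset /= <-; exact: completion_rank_le. Qed.

(* The range of the maximum is not a restriction, by [typical_rank_le]. *)
Definition max_typical_rank : nat :=
  \max_(r < (minn m n).+1 | `[< typical_rank r >]) r.

Lemma max_typical_rank_ge r : typical_rank r -> (r <= max_typical_rank)%N.
Proof.
move=> tr; have ltr : (r < (minn m n).+1)%N by rewrite ltnS typical_rank_le.
by apply: (bigop.leq_bigmax_cond (Ordinal ltr)); apply/asboolP.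
Qed.

End Completion.

(* Main.v *)
Require Import Defs.
From mathcomp Require Import all_boot all_order all_algebra.
From mathcomp Require Import all_classical all_reals all_analysis.
From mathcomp Require Import lra.

(** Fix r = k - 1.  A matrix of rank at most r is a table of inner products
    <u_i, v_j> of vectors of length r, so it is enough to show that the partial
    matrices of the form (<u_i, v_j>) over the edges (i, j) are dense: no
    nonempty open set of partial matrices can then consist of matrices of
    completion rank k or more.

    An empty k-core means that the graph is built from nothing by adding
    vertices one at a time, each with at most r neighbours among the vertices
    already present ([empty_core_low_degree]).  If the vectors on each side are
    in general position, the vector of the new vertex can be chosen to meet the
    at most r prescribed products exactly, since these are independent linear
    conditions in dimension r.  This choice may destroy general position on its
    own side, but an arbitrarily small perturbation restores it
    ([perturb_off_hyperplanes]), at the cost of an arbitrarily small error in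
    the new entries and none in the old ones ([add_vertex]).  The error is the
    reason for proving density rather than completability of every partial
    matrix, which is false in general. *)

Set Implicit Arguments.
Unset Strict Implicit.
Unset Printing Implicit Defensive.

Import Order.TTheory GRing.Theory Num.Theory.
Import numFieldNormedType.Exports.

Local Open Scope ring_scope.

(** * Vectors in general position *)

Section GeneralPosition.
Variables (R : realType) (r : nat).
Implicit Types (x y z : 'rV[R]_r).

Definition dot x y : R := (x *m y^T) 0 0.

Lemma dotE x y : dot x y = \sum_a x 0 a * y 0 a.
Proof. by rewrite /dot mxE; apply: eq_bigr => a _; rewrite mxE. Qed.

Lemma dotC x y : dot x y = dot y x.
Proof. by rewrite !dotE; apply: eq_bigr => a _; rewrite mulrC. Qed.

Lemma dotDl x y z : dot (x + y) z = dot x z + dot y z.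
Proof. by rewrite /dot mulmxDl mxE. Qed.

Lemma dotZl c x z : dot (c *: x) z = c * dot x z.
Proof. by rewrite /dot -scalemxAl mxE. Qed.

Lemma dotDr x y z : dot x (y + z) = dot x y + dot x z.
Proof. by rewrite dotC dotDl !(dotC x). Qed.

Lemma dotZr c x z : dot x (c *: z) = c * dot x z.
Proof. by rewrite dotC dotZl dotC. Qed.

Lemma dot_self_neq0 z : z != 0 -> dot z z != 0.
Proof.
apply: contra_neq; rewrite dotE => /eqP.
rewrite psumr_eq0 => [/allP z0|a _]; last by rewrite -expr2 sqr_ge0.
apply/rowP => a; rewrite mxE; apply/eqP.
by have := z0 a (mem_index_enum a); rewrite mulf_eq0 orbb.
Qed.

Lemma near0_affine_neq0 (a b : R) : (a != 0) || (b != 0) ->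
  \forall t \near (0^'+)%classic, a + t * b != 0.
Proof.
move=> ab; have [b0|b0] := eqVneq b 0.
  by move: ab; rewrite b0 eqxx orbF => a0; near=> t; rewrite mulr0 addr0.
have root t : a + t * b = 0 -> t = - a / b.
  by move=> /eqP; rewrite addr_eq0 => /eqP ->; rewrite opprK mulfK.
have [c0|c0] := leP (- a / b) 0.
  near=> t; apply/eqP => /root tE.
  have : 0 < t by near: t; exact: nbhs_right_gt.
  by rewrite tE ltNge c0.
near=> t; apply/eqP => /root tE.
have : t < - a / b by near: t; exact: nbhs_right_lt.
by rewrite tE ltxx.
Unshelve. all: by end_near. Qed.

Lemma near0_affine_lt (a b e : R) : `|a| < e ->
  \forall t \near (0^'+)%classic, `|a + t * b| < e.
Proof.
move=> ae; have b1 : 0 < `|b| + 1 by rewrite ltr_wpDl.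
near=> t.
have t0 : 0 < t by near: t; exact: nbhs_right_gt.
have : t < (e - `|a|) / (`|b| + 1).
  by near: t; apply: nbhs_right_lt; rewrite divr_gt0 // subr_gt0.
rewrite ltr_pdivlMr // => tb.
apply: le_lt_trans (ler_normD _ _) _; rewrite normrM (gtr0_norm t0).
by nra.
Unshelve. all: by end_near. Qed.

(** Hyperplanes have empty interior.  They are avoided one at a time: moving a
    little along the normal of a hyperplane leaves it, while the finitely many
    conditions already secured are open. *)
Lemma perturb_off_hyperplanes (J : finType) (w : J -> 'rV[R]_r)
    (zs : seq 'rV[R]_r) x (e : R) : 0 < e -> {in zs, forall z, z != 0} ->
  exists y, (forall j, `|dot y (w j) - dot x (w j)| < e) /\
            {in zs, forall z, dot y z != 0}.
Proof.
move=> e0; elim: zs => [_|z0 zs IH zs0].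
  by exists x; split=> // j; rewrite subrr normr0.
have [y [yw yz]] : exists y, (forall j, `|dot y (w j) - dot x (w j)| < e) /\
    {in zs, forall z, dot y z != 0}.
  by apply: IH => z zzs; apply: zs0; rewrite inE zzs orbT.
have nearw : \forall t \near (0^'+)%classic,
    forall j, `|dot (y + t *: z0) (w j) - dot x (w j)| < e.
  apply: filter_forall => j; have := near0_affine_lt (dot z0 (w j)) (yw j).
  by apply: filterS => t; rewrite dotDl dotZl addrAC.
have nearz : \forall t \near (0^'+)%classic, forall k : 'I_(size (z0 :: zs)),
    dot (y + t *: z0) (tnth (in_tuple (z0 :: zs)) k) != 0.
  apply: filter_forall => k; set z := tnth _ k.
  suff /near0_affine_neq0 : (dot y z != 0) || (dot z0 z != 0).
    by apply: filterS => t; rewrite dotDl dotZl.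
  have : z \in z0 :: zs by apply: mem_tnth.
  rewrite inE => /predU1P[->|/yz ->//].
  by rewrite dot_self_neq0 ?orbT // zs0 // mem_head.
have [t [tw tz]] := filter_ex (filterI nearw nearz).
exists (y + t *: z0); split=> // z /(tnthP (in_tuple (z0 :: zs)))[k ->].
exact: tz.
Qed.

(** General position of the vectors u_i for i in A, in dual form: any at most r
    of the functionals <u_i, -> take arbitrary prescribed values, that is, they
    are linearly independent.  Only this form is ever needed to solve for a new
    vector. *)
Definition general_position (I : finType) (u : I -> 'rV[R]_r) (A : {set I}) :=
  forall S : {set I}, S \subset A -> (#|S| <= r)%N ->
  forall b : I -> R, exists x, {in S, forall i, dot (u i) x = b i}.

Lemma fewer_vectors_orthogonal (I : finType) (u : I -> 'rV[R]_r) (T : {set I}) :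
  (#|T| < r)%N -> exists2 z, z != 0 & {in T, forall i, dot (u i) z = 0}.
Proof.
move=> Tr; pose W : 'M[R]_(r, #|T|) := \matrix_(a, e) u (enum_val e) 0 a.
have : kermx W != 0.
  rewrite kermx_eq0 /row_free; apply: contraTneq Tr => <-.
  by rewrite -leqNgt rank_leq_col.
move=> /rowV0Pn[z /sub_kermxP zW z0]; exists z => // i iT.
have zWi : (z *m W) 0 (enum_rank_in iT i) = 0 by rewrite zW mxE.
rewrite dotC dotE -[RHS]zWi mxE; apply: eq_bigr => a _.
by rewrite mxE enum_rankK_in.
Qed.

Definition update (I : eqType) (u : I -> 'rV[R]_r) i y :=
  fun i' => if i' == i then y else u i'.

Lemma general_position_update (I : finType) (u : I -> 'rV[R]_r) (A : {set I})
    (i : I) y :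
  general_position u A ->
  (forall T : {set I}, T \subset A -> i \notin T -> (#|T| < r)%N ->
     exists2 z, {in T, forall i', dot (u i') z = 0} & dot y z != 0) ->
  general_position (update u i y) (i |: A).
Proof.
move=> gpu yP S SA Sr b; rewrite /update.
have TA : S :\ i \subset A by rewrite finset.subDset.
have iT : i \notin S :\ i by rewrite !inE eqxx.
have TS := subset_leq_card (finset.subD1set S i).
have [x ux] := gpu _ TA (leq_trans TS Sr) b.
have [iS|iS] := boolP (i \in S); last first.
  exists x => i' i'S; have ni : i' != i by apply: contraNneq iS => <-.
  by rewrite (negPf ni) ux // !inE ni.
have Tr : (#|S :\ i| < r)%N by rewrite (finset.cardsD1 i S) iS add1n in Sr.
have [z uz yz] := yP _ TA iT Tr.
(* z is invisible on S :\ i, so a multiple of it corrects the value at i. *)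
exists (x + ((b i - dot y x) / dot y z) *: z) => i' i'S.
rewrite dotDr dotZr; case: eqVneq => [->|ni]; first by rewrite divfK // subrKC.
by rewrite ux ?uz ?mulr0 ?addr0 // !inE ni.
Qed.

(** The prescribed products with at most r vectors in general position can be
    attained; the approximation leaves room to push the solution off the
    hyperplanes where general position would fail. *)
Lemma add_vertex (I J : finType) (u : I -> 'rV[R]_r) (v : J -> 'rV[R]_r)
    (A : {set I}) (B N : {set J}) (i : I) (b : J -> R) (e : R) :
  0 < e -> general_position u A -> general_position v B ->
  N \subset B -> (#|N| <= r)%N ->
  exists y, general_position (update u i y) (i |: A) /\
            {in N, forall j, `|dot y (v j) - b j| < e}.
Proof.
move=> e0 gpu gpv NB Nr.
have [x xN] := gpv N NB Nr b.
have /choice[f fP] (T : {set I}) : exists z, (#|T| < r)%N ->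
    z != 0 /\ {in T, forall i', dot (u i') z = 0}.
  have [Tr|Tr] := ltnP #|T| r; last by exists 0.
  by have [z z0 zT] := fewer_vectors_orthogonal u Tr; exists z.
pose zs := [seq f T | T : {set I} <- enum {: {set I}} & (#|T| < r)%N].
have zs0 : {in zs, forall z, z != 0}.
  by move=> _ /mapP[T + ->]; rewrite mem_filter => /andP[Tr _];
    case: (fP T Tr).
have [y [yv yz]] := perturb_off_hyperplanes v x e0 zs0.
exists y; split=> [|j jN]; last by rewrite -(xN j jN) (dotC (v j)).
apply: general_position_update => // T _ _ Tr; exists (f T).
  by case: (fP T Tr).
by apply: yz; apply: map_f; rewrite mem_filter Tr mem_enum.
Qed.

End GeneralPosition.

(** * Density of low-rank partial matrices when the core is empty *)

(** If all degrees of the subgraph induced on A and B were at least k, it would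
    lie in the k-core, so A and B would be empty. *)
Lemma empty_core_low_degree (m n k : nat) (E : {set 'I_m * 'I_n})
    (A : {set 'I_m}) (B : {set 'I_n}) :
  k_core k E = null_bigraph m n ->
  [\/ A = finset.set0 /\ B = finset.set0,
      exists2 i, i \in A & (#|[set j in B | (i, j) \in E]%SET| < k)%N
    | exists2 j, j \in B & (#|[set i in A | (i, j) \in E]%SET| < k)%N].
Proof.
move=> core0; pose H : bigraph m n := (A, B, E :&: finset.setX A B).
have sH : is_subgraph E H by rewrite /is_subgraph finset.subsetIl finset.subsetIr.
have [dH|] := boolP (min_degree_ge k H).
  have [_ _ /(_ H sH dH)] := k_coreP k E.
  rewrite core0 /bigraph_le /= !finset.subset0 => /and3P[/eqP A0 /eqP B0 _].
  by apply: Or31.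
rewrite negb_and => /orP[] /forall_inPn[v vH]; rewrite -ltnNge => dv.
  apply: Or32; exists v => //; apply: leq_ltn_trans dv.
  have inj_pair : injective (pair v : 'I_n -> 'I_m * 'I_n) by move=> j j' [].
  rewrite -(card_imset _ inj_pair); apply: subset_leq_card.
  apply/fintype.subsetP => _ /imsetP[j + ->].
  by rewrite !inE /= eqxx => /andP[-> ->]; rewrite !andbT; exact: vH.
apply: Or33; exists v => //; apply: leq_ltn_trans dv.
have inj_pair : injective (fun i : 'I_m => (i, v)) by move=> i i' [].
rewrite -(card_imset _ inj_pair); apply: subset_leq_card.
apply/fintype.subsetP => _ /imsetP[i + ->].
by rewrite !inE /= eqxx => /andP[-> ->]; rewrite !andbT; exact: vH.
Qed.

(** General position is carried along the induction on the vertex sets A and B: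
    it is what makes the next vertex solvable.  The vertex removed has fewer
    than r + 1 neighbours in the other set, and replacing its vector does not
    change the products between the remaining ones. *)
Lemma empty_core_approximation (R : realType) (m n r : nat)
    (E : {set 'I_m * 'I_n}) (M : 'I_m -> 'I_n -> R) (e : R) :
  0 < e -> k_core r.+1 E = null_bigraph m n ->
  exists (u : 'I_m -> 'rV[R]_r) (v : 'I_n -> 'rV[R]_r),
    forall i j, (i, j) \in E -> `|dot (u i) (v j) - M i j| < e.
Proof.
move=> e0 core0.
suff build N (A : {set 'I_m}) (B : {set 'I_n}) : (#|A| + #|B| <= N)%N ->
    exists (u : 'I_m -> 'rV[R]_r) (v : 'I_n -> 'rV[R]_r),
    [/\ general_position u A, general_position v B &
      forall i j, i \in A -> j \in B -> (i, j) \in E ->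
        `|dot (u i) (v j) - M i j| < e].
  have [u [v [_ _ uv]]] := build _ [set: 'I_m]%SET [set: 'I_n]%SET (leqnn _).
  by exists u, v => i j ij; apply: uv; rewrite ?inE.
have subset_comprehension (T : finType) (S : {set T}) (P : pred T) :
    [set x in S | P x]%SET \subset S.
  by apply/fintype.subsetP => x; rewrite inE => /andP[].
elim: N A B => [|N IH] A B ABN.
  move: ABN; rewrite leqn0 addn_eq0 !cards_eq0 => /andP[/eqP -> /eqP ->].
  by exists (fun=> 0), (fun=> 0); split=> [S|S|i j]; rewrite ?inE //;
    rewrite finset.subset0 => /eqP -> _ b; exists 0 => i; rewrite inE.
case: (empty_core_low_degree A B core0) => [[-> ->]|[i iA iN]|[j jB jN]].
- by apply: IH; rewrite !cards0.
- have [|u [v [gpu gpv uv]]] := IH (A :\ i) B.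
    by move: ABN; rewrite (finset.cardsD1 i A) iA add1n addSn ltnS.
  have [y [gpy yN]] := add_vertex i (M i) e0 gpu gpv
    (subset_comprehension _ _ _) iN.
  exists (update u i y), v; split=> //; first by rewrite finset.setD1K in gpy.
  move=> i' j i'A jB ij; rewrite /update; case: eqVneq => [i'i|ni].
    by rewrite -i'i in yN *; apply: yN; rewrite !inE jB.
  by apply: uv; rewrite ?inE ?ni.
- have [|u [v [gpu gpv uv]]] := IH A (B :\ j).
    by move: ABN; rewrite (finset.cardsD1 j B) jB add1n addnS ltnS.
  have [y [gpy yN]] := add_vertex j (M^~ j) e0 gpv gpu
    (subset_comprehension _ _ _) jN.
  exists u, (update v j y); split=> //; first by rewrite finset.setD1K in gpy.
  move=> i j' iA j'B ij; rewrite /update; case: eqVneq => [j'j|nj].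
    by rewrite dotC; rewrite -j'j in yN *; apply: yN; rewrite !inE iA.
  by apply: uv; rewrite ?inE ?nj.
Qed.

Lemma rank_dot_table (R : realType) (m n r : nat)
    (u : 'I_m -> 'rV[R]_r) (v : 'I_n -> 'rV[R]_r) :
  (\rank (\matrix_(i, j) dot (u i) (v j)) <= r)%N.
Proof.
have -> : \matrix_(i, j) dot (u i) (v j) =
    (\matrix_i u i) *m (\matrix_j v j)^T.
  apply/matrixP => i j; rewrite !mxE dotE.
  by apply: eq_bigr => a _; rewrite !mxE.
by apply: leq_trans (mulmx_max_rank _ _) _.
Qed.

(** A nonempty open set on which the completion rank is s contains the
    restriction to E of some table of inner products of vectors of length
    k - 1. *)
Lemma typical_rank_lt_core (R : realType) (m n k : nat)
    (E : {set 'I_m * 'I_n}) (s : nat) :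
  (0 < k)%N -> k_core k E = null_bigraph m n -> typical_rank R E s -> (s < k)%N.
Proof.
case: k => // r _ core0 [M /nbhs_ballP[e /= e0 ballM]].
(* M as a table, extended by 0 off the edges. *)
pose M' i j : R := \sum_(f < #|E| | enum_val f == (i, j)) M ord0 f.
have [u [v uv]] := empty_core_approximation M' e0 core0.
pose A := \matrix_(i, j) dot (u i) (v j).
pose P : 'rV[R]_#|E| := \row_f A (enum_val f).1 (enum_val f).2.
have /ballM <- : ball M e P.
  split=> // i f; rewrite (ord1 i) /ball /= distrC !mxE.
  have -> : M ord0 f = M' (enum_val f).1 (enum_val f).2.
    rewrite /M' (big_pred1 f) // => g /=.
    by rewrite -surjective_pairing (inj_eq enum_val_inj).
  by apply: uv; rewrite -surjective_pairing enum_valP.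
rewrite ltnS /completion_rank; case: ex_minnP => t _ tmin.
apply: leq_trans (tmin (\rank A) _) (rank_dot_table u v).
by apply/asboolP; exists A => //; apply/forallP => f; rewrite [P _ _]mxE.
Qed.

Theorem corollary4p5 (R : realType) (m n : nat) (E : {set 'I_m * 'I_n})
    (k : nat) (hk : (0 < k)%N) (hcore : k_core k E = null_bigraph m n) :
  (max_typical_rank R E < k)%N.
Proof.
rewrite -(prednK hk) ltnS; apply/bigmax_leqP => s /asboolP ts.
by rewrite -ltnS (prednK hk); apply: typical_rank_lt_core ts.
Qed.
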